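(* Let $\Phi$ be a root system of type $B_n$, $C_n$ or $D_n$, with Weyl group $W$ and set of fundamental weight conjugates $\mathcal{L}\subset\mathbb{R}^n$. Let $\mathcal{G}$ be a $\Phi$-graph, and let $\mu_{\mathcal{G}}:\mathcal{L}\to\mathbb{R}$ be the Coxeter submodular function corresponding to $\mathcal{G}$. Then $x\in\mathbb{R}^n$ is a mean score sequence of a random Coxeter tournament on $\mathcal{G}$ if and only if $\langle\lambda,x\rangle\le\mu_{\mathcal{G}}(\lambda)$ for all $\lambda\in\mathcal{L}$.
   Context: Write $[n]=\{1,\dots,n\}$ and let $e_1,\dots,e_n$ be the standard basis of $\mathbb{R}^n$ with standard inner product $\langle\cdot,\cdot\rangle$. Root systems: $B_n=\{\pm e_i\pm e_j: i\ne j\}\cup\{\pm e_i\}$, $C_n=\{\pm e_i\pm e_j: i\ne j\}\cup\{\pm 2e_i\}$, $D_n=\{\pm e_i\pm e_j: i\neq j\}$. A root system is required to span $\mathbb{R}^n$, so $n\ge 2$ in type $D_n$. The Weyl group $W$ is generated by the reflections in the roots: in types $B_n$ and $C_n$ it is the group of all signed permutations of coordinates of $\mathbb{R}^n$, and in type $D_n$ the subgroup of signed permutations with an even number of sign changes. The fundamental weights $\lambda_1,\dots,\lambda_n$ (after identifying $(\mathbb{R}^n)^*$ with $\mathbb{R}^n$) are: in $B_n$: $e_1,\ e_1+e_2,\dots,\ e_1+\cdots+e_{n-1},\ \tfrac12(e_1+\cdots+e_n)$; in $C_n$: $e_1,\ e_1+e_2,\dots,\ e_1+\cdots+e_n$;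 in $D_n$: $e_1,\ e_1+e_2,\dots,\ e_1+\cdots+e_{n-2},\ \tfrac12(e_1+\cdots+e_{n-1}- e_n),\ \tfrac12(e_1+\cdots+e_{n-1}+ e_n)$. The set of fundamental weight conjugates is $\mathcal{L}=\{w\cdot\lambda_k: w\in W,\ k\in[n]\}$. A (simple) signed graph $\mathcal{G}$ on $[n]$ consists of a set of negative edges $E^-\subseteq\binom{[n]}{2}$, a set of positive edges $E^+\subseteq\binom{[n]}{2}$ (not necessarily disjoint from $E^-$), a set of half-edges $H\subseteq[n]$ and a set of loops $L\subseteq[n]$. For $\Phi$ of type $B_n$, $C_n$ or $D_n$, a $\Phi$-graph is a signed graph with: $L=\emptyset$ if $\Phi=B_n$; $H=\emptyset$ if $\Phi=C_n$; $H=L=\emptyset$ if $\Phi=D_n$. To $\mathcal{G}$ one associates the set of vectors (positive roots) $$\Gamma(\mathcal{G})=\{e_i-e_j: ij\in E^-,\ i>j\}\cup\{e_i+e_j: ij\in E^+,\ i>j\}\cup\{e_i: i\in H\}\cup\{2e_i: i\in L\}.$$ The Coxeter graphical zonotope of $\mathcal{G}$ is the Minkowski sum $Z_{\mathcal{G}}=\sum_{\alpha\in\Gamma(\mathcal{G})}[-\alpha/2,\alpha/2]$. The Coxeter submodular function corresponding to $\mathcal{G}$ is $\mu_{\mathcal{G}}(\lambda)=\max_{y\in Z_{\mathcal{G}}}\langle\lambda,y\rangle$ for $\lambda\in\mathcal{L}$. A random Coxeter tournament on $\mathcal{G}$ is a collection of numbers in $[0,1]$: $p_{ij}^-=1-p_{ji}^-$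 for each $ij\in E^-$; $p_{ij}^+=p_{ji}^+$ for each $ij\in E^+$; $p_i^h$ for each $i\in H$; $p_i^\ell$ for each $i\in L$. Its mean score sequence is the vector $x\in\mathbb{R}^n$ with coordinates $$x_i=\sum_{j:\,ij\in E^-}(p_{ij}^--\tfrac12)+\sum_{j:\,ij\in E^+}(p_{ij}^+-\tfrac12)+\mathbf{1}_{i\in H}(p_i^h-\tfrac12)+\mathbf{1}_{i\in L}\,2(p_i^\ell-\tfrac12).$$ *)

(* Defs.v *)
From HB Require Import structures.
From mathcomp Require Import all_boot all_order all_algebra.
From mathcomp Require Import boolp classical_sets functions cardinality fsbigop.
From mathcomp Require Import set_interval reals lra.

Set Implicit Arguments.
Unset Strict Implicit.
Unset Printing Implicit Defensive.

Import Order.TTheory GRing.Theory Num.Theory.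

Local Open Scope classical_set_scope.
Local Open Scope ring_scope.

(* The index set [n] = {1, ..., n} is represented by 'I_n = {0, ..., n-1},
   so that the mathematical index i is the ordinal i-1. *)

Section EuclideanSpace.
Variables (R : realType) (n : nat).
Implicit Types u v a : 'rV[R]_n.

Definition basis_vec (i : 'I_n) : 'rV[R]_n := delta_mx 0 i.

Definition dotp u v : R := \sum_(i < n) u 0 i * v 0 i.

Definition reflection a v : 'rV[R]_n := v - (2 * dotp v a / dotp a a) *: a.

Definition segment u v : set 'rV[R]_n :=
  [set (1 - t) *: u + t *: v | t in `[0, 1]%classic].

(* {y_1 + ... + y_m | y_k in S a_k} for A = {a_1, ..., a_m} finite; the sum
   would be 0 by convention if A were infinite. *)
Definition minkowski_sum (A : set 'rV[R]_n)
    (S : 'rV[R]_n -> set 'rV[R]_n) : set 'rV[R]_n :=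
  [set z | exists2 y : 'rV[R]_n -> 'rV[R]_n,
     (forall a, A a -> S a (y a)) & z = \sum_(a \in A) y a].

End EuclideanSpace.

Inductive root_type : Type := TypeB | TypeC | TypeD.

Section RootSystems.
Variables (R : realType) (n : nat).
Implicit Type Phi : root_type.

Local Notation e := (@basis_vec R n).

Definition pair_roots : set 'rV[R]_n :=
  [set v | exists (i j : 'I_n) (b c : bool),
     i != j /\ v = (-1) ^+ b *: e i + (-1) ^+ c *: e j].

Definition axis_roots (m : R) : set 'rV[R]_n :=
  [set v | exists (i : 'I_n) (b : bool), v = (-1) ^+ b *: (m *: e i)].

Definition root_system Phi : set 'rV[R]_n :=
  match Phi with
  | TypeB => pair_roots `|` axis_roots 1
  | TypeC => pair_roots `|` axis_roots 2
  | TypeD => pair_roots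
  end.

(* Reflections are involutions, so the words in the reflections already form
   the group that they generate. *)
Inductive weyl_group Phi : set ('rV[R]_n -> 'rV[R]_n) :=
  | weyl_id : weyl_group Phi id
  | weyl_reflection a w : root_system Phi a -> weyl_group Phi w ->
      weyl_group Phi (reflection a \o w).

(* The ordinal k stands for the index k+1.  In type D with k.+2 = n, the
   second sum below has e_n as its only term. *)
Definition fundamental_weight Phi (k : 'I_n) : 'rV[R]_n :=
  let s := \sum_(i < n | (i <= k)%N) e i in
  match Phi with
  | TypeB => if k.+1 == n then 2^-1 *: s else s
  | TypeC => s
  | TypeD =>
      if k.+1 == n then 2^-1 *: s
      else if k.+2 == n then 2^-1 *: (s - \sum_(i < n | (k < i)%N) e i)
      else s
  end.

Definition weight_conjugates Phi : set 'rV[R]_n :=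
  [set l | exists2 w, weyl_group Phi w &
     exists k : 'I_n, l = w (fundamental_weight Phi k)].

End RootSystems.

Record signed_graph (n : nat) := SignedGraph {
  neg_edges : {set {set 'I_n}};
  pos_edges : {set {set 'I_n}};
  half_edges : {set 'I_n};
  loops : {set 'I_n};
  neg_edges_card2 : forall E, E \in neg_edges -> #|E| = 2%N;
  pos_edges_card2 : forall E, E \in pos_edges -> #|E| = 2%N
}.

Definition neg_adj n (G : signed_graph n) (i j : 'I_n) : bool :=
  [set i; j]%SET \in neg_edges G.

Definition pos_adj n (G : signed_graph n) (i j : 'I_n) : bool :=
  [set i; j]%SET \in pos_edges G.

Definition is_Phi_graph n (Phi : root_type) (G : signed_graph n) : Prop :=
  match Phi with
  | TypeB => loops G = finset.set0
  | TypeC => half_edges G = finset.set0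
  | TypeD => half_edges G = finset.set0 /\ loops G = finset.set0
  end.

Section GraphicalZonotope.
Variables (R : realType) (n : nat) (G : signed_graph n).

Local Notation e := (@basis_vec R n).

Definition graph_roots : set 'rV[R]_n :=
  [set v | exists i j : 'I_n, [/\ (j < i)%N, neg_adj G i j & v = e i - e j]]
  `|` [set v | exists i j : 'I_n, [/\ (j < i)%N, pos_adj G i j & v = e i + e j]]
  `|` [set v | exists2 i : 'I_n, i \in half_edges G & v = e i]
  `|` [set v | exists2 i : 'I_n, i \in loops G & v = 2 *: e i].

Definition zonotope : set 'rV[R]_n :=
  minkowski_sum graph_roots (fun a => segment (- (2^-1 *: a)) (2^-1 *: a)).

(* The supremum is a maximum: see graph_mu_max. *)
Definition graph_mu (l : 'rV[R]_n) : R := sup [set dotp l y | y in zonotope].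

End GraphicalZonotope.

(* The values of the four families outside the (half-)edges and loops of G
   are irrelevant. *)
Record coxeter_tournament (R : realType) n (G : signed_graph n) :=
  CoxeterTournament {
  p_neg : 'I_n -> 'I_n -> R;
  p_pos : 'I_n -> 'I_n -> R;
  p_half : 'I_n -> R;
  p_loop : 'I_n -> R;
  p_neg_bounds : forall i j, neg_adj G i j -> 0 <= p_neg i j <= 1;
  p_neg_anti : forall i j, neg_adj G i j -> p_neg i j = 1 - p_neg j i;
  p_pos_bounds : forall i j, pos_adj G i j -> 0 <= p_pos i j <= 1;
  p_pos_sym : forall i j, pos_adj G i j -> p_pos i j = p_pos j i;
  p_half_bounds : forall i, i \in half_edges G -> 0 <= p_half i <= 1;
  p_loop_bounds : forall i, i \in loops G -> 0 <= p_loop i <= 1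
}.

Definition mean_score (R : realType) n (G : signed_graph n)
    (T : coxeter_tournament R G) : 'rV[R]_n :=
  \row_i (\sum_(j < n | neg_adj G i j) (p_neg T i j - 2^-1)
          + \sum_(j < n | pos_adj G i j) (p_pos T i j - 2^-1)
          + (if i \in half_edges G then p_half T i - 2^-1 else 0)
          + (if i \in loops G then 2 * (p_loop T i - 2^-1) else 0)).

Section Maximum.
Variables (R : realType) (n : nat) (G : signed_graph n).

Lemma graph_roots_finite : finite_set (@graph_roots R n G).
Proof.
rewrite /graph_roots !finite_setU; split; [split; [split|]|].
- apply: (@sub_finite_set _ _ [set basis_vec R p.1 - basis_vec R p.2 |
    p in [set: 'I_n * 'I_n]]); last exact/finite_image/finite_finset.
  by move=> v [i [j [_ _ ->]]]; exists (i, j).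
- apply: (@sub_finite_set _ _ [set basis_vec R p.1 + basis_vec R p.2 |
    p in [set: 'I_n * 'I_n]]); last exact/finite_image/finite_finset.
  by move=> v [i [j [_ _ ->]]]; exists (i, j).
- apply: (@sub_finite_set _ _ [set basis_vec R i | i in [set: 'I_n]]);
    last exact/finite_image/finite_finset.
  by move=> v [i _ ->]; exists i.
- apply: (@sub_finite_set _ _ [set 2 *: basis_vec R i | i in [set: 'I_n]]);
    last exact/finite_image/finite_finset.
  by move=> v [i _ ->]; exists i.
Qed.

Lemma dotpZr (l a : 'rV[R]_n) c : dotp l (c *: a) = c * dotp l a.
Proof.
by rewrite /dotp mulr_sumr; apply: eq_bigr => i _; rewrite mxE mulrCA.
Qed.

Lemma dotp_fsumr (l : 'rV[R]_n) (A : set 'rV[R]_n) F : finite_set A ->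
  dotp l (\sum_(a \in A) F a) = \sum_(a \in A) dotp l (F a).
Proof.
move=> finA; rewrite !fsbig_finite // /dotp exchange_big /=.
by apply: eq_bigr => i _; rewrite summxE mulr_sumr.
Qed.

Lemma graph_mu_max (l : 'rV[R]_n) :
  (exists2 y, zonotope G y & dotp l y = graph_mu G l) /\
  (forall y, zonotope G y -> dotp l y <= graph_mu G l).
Proof.
have finG := graph_roots_finite.
pose c (a : 'rV[R]_n) : R := if 0 <= dotp l a then 1 else 0.
pose y0 (a : 'rV[R]_n) := (1 - c a) *: - (2^-1 *: a) + c a *: (2^-1 *: a).
pose z0 := \sum_(a \in graph_roots G) y0 a.
have Zz0 : zonotope G z0.
  exists y0 => // a _; exists (c a) => //=.
  by rewrite in_itv /= /c; case: ifP => _; rewrite ?lexx ?ler01.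
have ub y : zonotope G y -> dotp l y <= dotp l z0.
  case=> f fG ->; rewrite !dotp_fsumr // !fsbig_finite //.
  rewrite big_seq [leRHS]big_seq; apply: ler_sum => a.
  rewrite in_fset_set // inE => /fG [t /=]; rewrite in_itv /= => /andP[t0 t1] <-.
  rewrite /y0 -!scaleNr !scalerA -!scalerDl !dotpZr /c.
  have hlu (s : R) : 0 <= s -> s <= 1 ->
      (1 - s) * - 2^-1 + s / 2 <= (1 - 1) * - 2^-1 + 1 / 2 /\
      (1 - 0) * - 2^-1 + 0 / 2 <= (1 - s) * - 2^-1 + s / 2.
    by move=> s0 s1; split; lra.
  case: ifPn => la; first by rewrite ler_wpM2r //; exact: (hlu _ t0 t1).1.
  apply: ler_wnM2r; last exact: (hlu _ t0 t1).2.
  by apply: ltW; rewrite ltNge.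
have E : graph_mu G l = dotp l z0.
  apply/eqP; rewrite eq_le; apply/andP; split.
    by apply: ge_sup; [exists (dotp l z0), z0|move=> _ [y Zy <-]; exact: ub].
  apply: ub_le_sup; last by exists z0.
  by exists (dotp l z0) => _ [y Zy <-]; exact: ub.
by rewrite E; split; [exists z0|].
Qed.

End Maximum.

(* Main.v *)
Require Import Defs.
From mathcomp Require Import all_boot all_order all_algebra perm.
From mathcomp Require Import boolp classical_sets functions cardinality fsbigop.
From mathcomp Require Import reals lra ring zify.

(** Write h(l) for the sum of |<l, a>| / 2 over the positive roots a attached to
    the graph.  This is the support function of the zonotope, so it agrees with
    mu on the weight conjugates ([graph_muE]).

    Grouping the terms of a mean score by edge shows that mean score sequences
    are exactly the sums of c_a a over the roots, with every |c_a| <= 1/2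
    ([mean_score_roots], [tournament_of_coefficients]).  Such a combination
    plainly satisfies <l, x> <= h(l) for every l.  Conversely, a vector x with
    <l, x> <= h(l) for every l is such a combination: this is a separation
    theorem for zonotopes ([segment_sum_separation]), proved by splitting off one
    segment at a time.  Removing the segment of a root a asks for one number t
    that makes x - t a satisfy the inequalities of the remaining segments; each l
    with <l, a> = 1 bounds t from below, each l with <l, a> = -1 bounds it from
    above, and the bounds are compatible because h is subadditive.  So t is the
    supremum of a bounded set of reals, as in the one-dimensional step of the
    Hahn-Banach theorem.

    It remains to deduce the inequality for every l from the weight conjugates.
    The function h is additive on any two vectors that pair with each root with
    the same weak sign ([support_funD]).  Any l is a nonnegative combination of
    vectors with entries in {-1, 0, 1} of decreasing support, obtained by
    repeatedly subtracting m times the sign vector of l, where m is the least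
    nonzero |l_i|; these subtractions preserve the signs of the pairings with the
    roots ([sign_vector_ineq]).  In types B and C every nonzero sign vector is a
    positive multiple of a weight conjugate.  In type D this fails exactly for
    the supports of size n - 1 ([sign_vector_conjugate]), but such an s is half
    the sum of the full sign vectors s + e_m and s - e_m, which pair with the
    roots of type D with the same weak signs, so the missing inequalities follow
    from the two spin weights ([sign_vector_ineq_spin]). *)

Set Implicit Arguments.
Unset Strict Implicit.
Unset Printing Implicit Defensive.

Import Order.TTheory GRing.Theory Num.Theory.
Local Open Scope ring_scope.

(** * The standard inner product *)

Section InnerProduct.
Variables (R : realType) (n : nat).
Implicit Types u v l a x : 'rV[R]_n.

Local Notation e := (@basis_vec R n).

Lemma dotpC u v : dotp u v = dotp v u.
Proof. by apply: eq_bigr => i _; rewrite mulrC. Qed.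

Lemma dotpDr l u v : dotp l (u + v) = dotp l u + dotp l v.
Proof. by rewrite -big_split; apply: eq_bigr => i _; rewrite mxE mulrDr. Qed.

Lemma dotpNr l u : dotp l (- u) = - dotp l u.
Proof. by rewrite -scaleN1r dotpZr mulN1r. Qed.

Lemma dotpBr l u v : dotp l (u - v) = dotp l u - dotp l v.
Proof. by rewrite dotpDr dotpNr. Qed.

Lemma dotpDl u v l : dotp (u + v) l = dotp u l + dotp v l.
Proof. by rewrite !(dotpC _ l) dotpDr. Qed.

Lemma dotpZl c u l : dotp (c *: u) l = c * dotp u l.
Proof. by rewrite !(dotpC _ l) dotpZr. Qed.

Lemma dotp_sumr (I : Type) (s : seq I) (P : pred I) (F : I -> 'rV[R]_n) l :
  dotp l (\sum_(i <- s | P i) F i) = \sum_(i <- s | P i) dotp l (F i).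
Proof.
apply: (big_morph (dotp l) (dotpDr l)).
by rewrite /dotp big1 // => i _; rewrite mxE mulr0.
Qed.

Lemma basis_vecE i j : e i 0 j = (j == i)%:R.
Proof. by rewrite /basis_vec mxE. Qed.

Lemma dotp_basis l i : dotp l (e i) = l 0 i.
Proof.
rewrite /dotp (bigD1 i) //= basis_vecE eqxx mulr1 big1 ?addr0 // => j ji.
by rewrite basis_vecE (negPf ji) mulr0.
Qed.

Lemma dotp_self_le0 x : dotp x x <= 0 -> x = 0.
Proof.
move=> xx; apply/rowP => i; rewrite mxE; apply/eqP.
rewrite -sqrf_eq0 expr2 eq_le -expr2 sqr_ge0 andbT expr2.
apply: le_trans xx; rewrite /dotp (bigD1 i) //= lerDl.
by apply: sumr_ge0 => j _; rewrite -expr2 sqr_ge0.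
Qed.

End InnerProduct.

(** * Separation for sums of segments *)

Section Separation.
Variables (R : realType) (n : nat).
Implicit Types l a x : 'rV[R]_n.

Local Open Scope classical_set_scope.

(** Rescaling l so that <l, a> is 1 or -1 turns the conclusion into lower and
    upper bounds on t.  A lower bound from l and an upper bound from l' are
    compatible because <l + l', a> = 0, so that the hypothesis at l + l' does
    not see the segment; the supremum of the lower bounds is then a solution.
    Adding -1/2 to the lower bounds gives t >= -1/2 and a nonempty set. *)
Lemma peel_segment (h : 'rV[R]_n -> R) a x :
    (forall t l, 0 <= t -> h (t *: l) = t * h l) ->
    (forall l l', h (l + l') <= h l + h l') ->
    (forall l, dotp l x <= h l + `|dotp l a| / 2) ->
  exists2 t : R, `|t| <= 2^-1 & forall l, dotp l (x - t *: a) <= h l.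
Proof.
move=> hZ hD hx.
pose E := [set dotp l x - h l | l in [set l | dotp l a = 1]] `|` [set - 2^-1].
have E0 : E !=set0 by exists (- 2^-1); right.
have ubE b : - 2^-1 <= b -> (forall l, dotp l a = 1 -> dotp l x - h l <= b) ->
    ubound E b.
  by move=> b0 bl _ [[l /= la <-]|->]; [exact: bl|].
have le12 : ubound E 2^-1.
  apply: ubE => [|l la]; first by lra.
  by have := hx l; rewrite la normr1; lra.
have Et u : E u -> u <= sup E by apply: ub_le_sup; exists 2^-1.
exists (sup E) => [|l].
  rewrite ler_norml; apply/andP; split; first by apply: Et; right.
  exact: ge_sup.
rewrite dotpBr dotpZr.
have [la|la|la] := ltgtP (dotp l a) 0; last by have := hx l; rewrite la normr0; lra.
- pose d := - dotp l a; have d0 : 0 < d by rewrite oppr_gt0.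
  have d1 : 0 <= d^-1 by rewrite invr_ge0 ltW.
  have l'a : dotp (d^-1 *: l) a = -1.
    by rewrite dotpZl -[dotp l a]opprK mulrN mulVf ?gt_eqF.
  suff : sup E <= h (d^-1 *: l) - dotp (d^-1 *: l) x.
    rewrite hZ // dotpZl -mulrBr -(ler_pM2l d0) mulrA mulfV ?gt_eqF // mul1r /d.
    by lra.
  apply: ge_sup => //; apply: ubE => [|m ma].
    by have := hx (d^-1 *: l); rewrite l'a normrN1; lra.
  have := hx (m + d^-1 *: l); have := hD m (d^-1 *: l).
  by rewrite !dotpDl ma l'a subrr normr0; lra.
- have d1 : 0 <= (dotp l a)^-1 by rewrite invr_ge0 ltW.
  suff : dotp ((dotp l a)^-1 *: l) x - h ((dotp l a)^-1 *: l) <= sup E.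
    rewrite hZ // dotpZl -mulrBr -(ler_pM2l la) mulrA mulfV ?gt_eqF // mul1r.
    by lra.
  by apply: Et; left; exists ((dotp l a)^-1 *: l) => //=; rewrite dotpZl mulVf ?gt_eqF.
Qed.

(** Induction on the list by [peel_segment].  Once no segment is left, the
    inequality at l = x says that x has nonpositive square norm. *)
Lemma segment_sum_separation (I : eqType) (r : I -> 'rV[R]_n) (s : seq I) x :
    uniq s -> (forall l, dotp l x <= \sum_(i <- s) `|dotp l (r i)| / 2) ->
  exists2 c : I -> R, forall i, `|c i| <= 2^-1 & x = \sum_(i <- s) c i *: r i.
Proof.
elim: s x => [|i s IH] x /=.
  move=> _ hx; exists (fun=> 0) => [i|]; first by rewrite normr0 invr_ge0.
  by rewrite big_nil; apply: dotp_self_le0; have := hx x; rewrite big_nil.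
move=> /andP[iNs us] hx.
have [ | |l|t t1 /(IH _ us)[c c1 xc]] := @peel_segment
    (fun l => \sum_(i <- s) `|dotp l (r i)| / 2) (r i) x.
- move=> t l t0; rewrite mulr_sumr; apply: eq_bigr => j _.
  by rewrite dotpZl normrM (ger0_norm t0) mulrA.
- move=> l l'; rewrite -big_split; apply: ler_sum => j _ /=.
  by rewrite -mulrDl ler_pM2r ?invr_gt0 // dotpDl ler_normD.
- by have := hx l; rewrite big_cons addrC.
exists (fun j => if j == i then t else c j) => [j|]; first by case: ifP.
rewrite big_cons eqxx -[LHS](subrK (t *: r i)) xc addrC; congr (_ + _).
by rewrite !big_seq; apply: eq_bigr => j js; case: eqP => // ji; rewrite -ji js in iNs.
Qed.

End Separation.

(** * Sums over the roots of a signed graph *)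

Section Adjacency.
Variables (n : nat) (G : signed_graph n).
Implicit Types i j : 'I_n.

Lemma neg_adjC i j : neg_adj G i j = neg_adj G j i.
Proof. by rewrite /neg_adj finset.setUC. Qed.

Lemma pos_adjC i j : pos_adj G i j = pos_adj G j i.
Proof. by rewrite /pos_adj finset.setUC. Qed.

Lemma neg_adjii i : neg_adj G i i = false.
Proof.
by apply/negP => /neg_edges_card2; rewrite finset.setUid cards1.
Qed.

Lemma pos_adjii i : pos_adj G i i = false.
Proof.
by apply/negP => /pos_edges_card2; rewrite finset.setUid cards1.
Qed.

(** An edge has two ordered pairs of ends but a single root, so roots are indexed
    by the pairs with decreasing entries. *)
Definition neg_arc (p : 'I_n * 'I_n) : bool := (p.2 < p.1)%N && neg_adj G p.1 p.2.
Definition pos_arc (p : 'I_n * 'I_n) : bool := (p.2 < p.1)%N && pos_adj G p.1 p.2.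

End Adjacency.

Lemma fsbig_image_finType (R : Type) (idx : R) (op : Monoid.com_law idx)
    (T : finType) (V : choiceType) (P : pred T) (h : T -> V) (F : V -> R) :
    {in P &, injective h} ->
  \big[op/idx]_(a \in [set h t | t in [set` P]]%classic) F a
  = \big[op/idx]_(t | P t) F (h t).
Proof.
move=> hI; rewrite fsbig_image; last first.
  by move=> s t; rewrite !inE; exact: hI.
by rewrite -(@bigfs _ _ op _ (index_enum T) P) ?index_enum_uniq // => i; rewrite mem_index_enum.
Qed.

Section Roots.
Variables (R : realType) (n : nat) (G : signed_graph n).

Local Notation e := (@basis_vec R n).

Definition neg_root (p : 'I_n * 'I_n) : 'rV[R]_n := e p.1 - e p.2.
Definition pos_root (p : 'I_n * 'I_n) : 'rV[R]_n := e p.1 + e p.2.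
Definition loop_root (i : 'I_n) : 'rV[R]_n := 2 *: e i.

Lemma neg_rootE p k : neg_root p 0 k = (k == p.1)%:R - (k == p.2)%:R.
Proof. by rewrite /neg_root mxE [X in _ + X]mxE !basis_vecE. Qed.

Lemma pos_rootE p k : pos_root p 0 k = (k == p.1)%:R + (k == p.2)%:R.
Proof. by rewrite /pos_root mxE !basis_vecE. Qed.

Lemma basis_vec_inj : injective e.
Proof.
move=> i j /(congr1 (fun v : 'rV[R]_n => v 0 i)); rewrite !basis_vecE eqxx.
by case: eqP => // _ /eqP; rewrite oner_eq0.
Qed.

Lemma loop_root_inj : injective loop_root.
Proof. by move=> i j /(scalerI _) /basis_vec_inj -> //; rewrite pnatr_eq0. Qed.

Lemma neg_root_inj : {in neg_arc G &, injective neg_root}.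
Proof.
move=> [i j] [k l]; rewrite /in_mem /= /neg_arc /= => /andP[ji _] /andP[lk _] E.
have ij : (i == j) = false by rewrite -val_eqE gtn_eqF.
have ik : i = k.
  move: E => /(congr1 (fun v : 'rV[R]_n => v 0 i)); rewrite !neg_rootE /= eqxx ij.
  by case: eqP => // _; case: eqP => _ /= h; exfalso; lra.
have jl : j = l.
  move: E => /(congr1 (fun v : 'rV[R]_n => v 0 j)); rewrite !neg_rootE /= eqxx (eq_sym j i) ij.
  by case: (j =P l) => // _; case: eqP => _ /= {ik}h; exfalso; lra.
by rewrite ik jl.
Qed.

Lemma pos_root_inj : {in pos_arc G &, injective pos_root}.
Proof.
move=> [i j] [k l]; rewrite /in_mem /= /pos_arc /= => /andP[ji _] /andP[lk _] E.
have ij : (i == j) = false by rewrite -val_eqE gtn_eqF.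
have ikl : (i == k) || (i == l).
  move: E => /(congr1 (fun v : 'rV[R]_n => v 0 i)); rewrite !pos_rootE /= eqxx ij.
  by case: eqP => //= _; case: eqP => //= _; lra.
have jkl : (j == k) || (j == l).
  move: E => /(congr1 (fun v : 'rV[R]_n => v 0 j)); rewrite !pos_rootE /= eqxx (eq_sym j i) ij.
  by case: eqP => //= _; case: eqP => //= _; lra.
case/orP: ikl ji ij => /eqP->; case/orP: jkl => /eqP-> //; rewrite ?eqxx ?ltnn //.
by move/ltn_trans => /(_ _ lk); rewrite ltnn.
Qed.

(** Together with the entry at a vertex, the sum of the entries tells the four
    kinds of roots apart. *)
Definition coord_sum (v : 'rV[R]_n) : R := dotp (const_mx 1) v.

Lemma coord_sum_basis i : coord_sum (e i) = 1.
Proof. by rewrite /coord_sum dotp_basis mxE. Qed.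

Lemma coord_sum_neg_root p : coord_sum (neg_root p) = 0.
Proof. by rewrite /coord_sum dotpBr -!/(coord_sum _) !coord_sum_basis subrr. Qed.

Lemma coord_sum_pos_root p : coord_sum (pos_root p) = 2.
Proof. by rewrite /coord_sum dotpDr -!/(coord_sum _) !coord_sum_basis. Qed.

Lemma coord_sum_loop_root i : coord_sum (loop_root i) = 2.
Proof. by rewrite /coord_sum dotpZr -/(coord_sum _) coord_sum_basis mulr1. Qed.

Lemma graph_roots_images : @graph_roots R n G =
  ([set neg_root p | p in [set` neg_arc G]] `|`
   [set pos_root p | p in [set` pos_arc G]] `|`
   [set e i | i in [set` half_edges G]] `|`
   [set loop_root i | i in [set` loops G]])%classic.
Proof.
rewrite /graph_roots; congr (_ `|` _ `|` _ `|` _)%classic; apply/seteqP; split.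
- by move=> v [i [j [ji adj ->]]]; exists (i, j) => //; apply/andP.
- by move=> v [[i j] /andP[ji adj] <-]; exists i, j.
- by move=> v [i [j [ji adj ->]]]; exists (i, j) => //; apply/andP.
- by move=> v [[i j] /andP[ji adj] <-]; exists i, j.
- by move=> v [i iH ->]; exists i.
- by move=> v [i iH <-]; exists i.
- by move=> v [i iH ->]; exists i.
- by move=> v [i iH <-]; exists i.
Qed.

(** The roots form a set, while scores and tournaments are indexed by edges; the
    two agree because distinct edges, half-edges and loops have distinct
    roots. *)
Lemma fsbig_graph_roots (V : nmodType) (F : 'rV[R]_n -> V) :
  \sum_(a \in @graph_roots R n G) F a =
    \sum_(p | neg_arc G p) F (neg_root p) + \sum_(p | pos_arc G p) F (pos_root p)
    + \sum_(i in half_edges G) F (e i) + \sum_(i in loops G) F (loop_root i).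
Proof.
have fin := @graph_roots_finite R n G.
rewrite graph_roots_images in fin *.
move: (fin); rewrite !finite_setU => -[[[finN finP] finH] finL].
rewrite fsbigU0 //; first 1 last.
- by rewrite !finite_setU.
- move=> v [[[[[i j] _ <-]|[[i j] /andP[ji _] <-]]|[i _ <-]] [k _ E]].
  + move: E => /(congr1 coord_sum).
    by rewrite coord_sum_neg_root coord_sum_loop_root; lra.
  + move: E => /(congr1 (dotp (e i))); rewrite dotpZr dotp_basis basis_vecE.
    rewrite dotpC dotp_basis pos_rootE /= eqxx.
    have -> : (i == j) = false by rewrite -val_eqE gtn_eqF.
    by case: eqP => _ /=; lra.
  + move: E => /(congr1 coord_sum).
    by rewrite coord_sum_basis coord_sum_loop_root; lra.
rewrite fsbigU0 //; first 1 last.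
- by rewrite !finite_setU.
- move=> v [[[[i j] _ <-]|[[i j] /andP[ji _] <-]] [k _ E]].
  + move: E => /(congr1 coord_sum).
    by rewrite coord_sum_basis coord_sum_neg_root; lra.
  + move: E => /(congr1 coord_sum).
    by rewrite coord_sum_basis coord_sum_pos_root; lra.
rewrite fsbigU0 //; first 1 last.
- move=> v [[[i j] _ <-] [[k l] _ E]].
  move: E => /(congr1 coord_sum).
  by rewrite coord_sum_pos_root coord_sum_neg_root; lra.
rewrite !fsbig_image_finType //; try exact: neg_root_inj; try exact: pos_root_inj.
- by move=> i j _ _ /loop_root_inj.
- by move=> i j _ _ /basis_vec_inj.
Qed.

Definition support_fun (l : 'rV[R]_n) : R :=
  \sum_(a \in @graph_roots R n G) `|dotp l a| / 2.

(** A linear form is maximal on a segment [-a/2, a/2] at the end chosen by the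
    sign of <l, a>, with value |<l, a>| / 2. *)
Lemma graph_muE l : graph_mu G l = support_fun l.
Proof.
have finG := @graph_roots_finite R n G.
have [[y [f fG ->] <-] ub] := graph_mu_max G l.
apply/eqP; rewrite eq_le; apply/andP; split.
  rewrite dotp_fsumr // /support_fun !fsbig_finite // big_seq [leRHS]big_seq.
  apply: ler_sum => a; rewrite in_fset_set // inE => /fG [t /= + <-].
  rewrite in_itv /= => /andP[t0 t1].
  rewrite dotpDr !dotpZr dotpNr dotpZr.
  by case: (ger0P (dotp l a)) => la; nra.
pose t (a : 'rV[R]_n) : R := if 0 <= dotp l a then 1 else 0.
have -> : support_fun l =
    dotp l (\sum_(a \in @graph_roots R n G)
              ((1 - t a) *: - (2^-1 *: a) + t a *: (2^-1 *: a))).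
  rewrite dotp_fsumr // /support_fun !fsbig_finite //.
  apply: eq_bigr => a _; rewrite dotpDr !dotpZr dotpNr dotpZr /t.
  by case: (ger0P (dotp l a)) => la /=; lra.
apply: ub; exists (fun a => (1 - t a) *: - (2^-1 *: a) + t a *: (2^-1 *: a)) => //.
move=> a _; exists (t a) => //=.
by rewrite in_itv /= /t; case: (0 <= dotp l a) => /=; rewrite ?lexx ?ler01.
Qed.

(** Each vertex k collects w k j from its neighbours j.  On the right an edge is
    counted once, contributing to its larger end with weight 1 and to its smaller
    end with weight s.  Negative edges use s = -1 (a match with a winner),
    positive edges s = 1 (a collaboration). *)
Lemma edge_sum (adj : rel 'I_n) (w : 'I_n -> 'I_n -> R) (s : R) k :
    symmetric adj -> irreflexive adj ->
    (forall i j, adj i j -> w i j = s * w j i) ->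
  \sum_(j | adj k j) w k j =
  \sum_(p : 'I_n * 'I_n | (p.2 < p.1)%N && adj p.1 p.2)
    w p.1 p.2 * ((k == p.1)%:R + s * (k == p.2)%:R).
Proof.
move=> adjC adjI wC.
rewrite -(pair_big_dep xpredT (fun i j : 'I_n => (j < i)%N && adj i j)
  (fun i j => w i j * ((k == i)%:R + s * (k == j)%:R))) /=.
under [RHS]eq_bigr do (under eq_bigr do rewrite mulrDr; rewrite big_split).
rewrite big_split /= (bigID (fun j : 'I_n => (j < k)%N)) /=; congr (_ + _).
  rewrite [RHS](bigD1 k) //= [X in _ + X]big1 ?addr0 => [|i ik].
    by apply: eq_big => [j|j _]; rewrite 1?andbC // eqxx mulr1.
  by rewrite big1 // => j _; rewrite eq_sym (negPf ik) mulr0.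
rewrite (exchange_big_dep xpredT) //= [RHS](bigD1 k) //= [X in _ + X]big1 ?addr0 => [|i ik].
  apply: eq_big => [j|j /andP[kj _]]; last by rewrite eqxx mulr1 mulrC; exact: wC.
  rewrite (adjC j k) -leqNgt leq_eqVlt andbC.
  by have [/val_inj->|//] := eqVneq (val k) (val j); rewrite adjI !andbF.
by rewrite big1 // => j _; rewrite eq_sym (negPf ik) mulr0 mulr0.
Qed.

End Roots.

(** * Mean scores as points of the zonotope *)

Section MeanScores.
Variables (R : realType) (n : nat) (G : signed_graph n).

Local Notation e := (@basis_vec R n).

Lemma mean_score_roots (T : coxeter_tournament R G) : mean_score T =
  \sum_(p | neg_arc G p) (p_neg T p.1 p.2 - 2^-1) *: neg_root R p
  + \sum_(p | pos_arc G p) (p_pos T p.1 p.2 - 2^-1) *: pos_root R p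
  + \sum_(i in half_edges G) (p_half T i - 2^-1) *: e i
  + \sum_(i in loops G) (p_loop T i - 2^-1) *: loop_root R i.
Proof.
have indic (A : {set 'I_n}) (f : 'I_n -> R) k :
    (if k \in A then f k else 0) = \sum_(i in A) f i * (k == i)%:R.
  case: ifPn => kA.
    rewrite (bigD1 k) //= eqxx mulr1 big1 ?addr0 // => i /andP[_ ik].
    by rewrite eq_sym (negPf ik) mulr0.
  by rewrite big1 // => i iA; case: eqP kA => [->|]; rewrite ?iA ?mulr0.
apply/rowP => k; rewrite [LHS]mxE.
have addE (u v : 'rV[R]_n) : (u + v) 0 k = u 0 k + v 0 k by rewrite mxE.
rewrite !addE !summxE; congr (_ + _ + _ + _).
- rewrite (@edge_sum _ _ (neg_adj G) (fun i j => p_neg T i j - 2^-1) (- 1)).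
  + by apply: eq_bigr => p _; rewrite mxE neg_rootE mulN1r.
  + by move=> i j; rewrite neg_adjC.
  + by move=> i; rewrite neg_adjii.
  + by move=> i j /(p_neg_anti T); lra.
- rewrite (@edge_sum _ _ (pos_adj G) (fun i j => p_pos T i j - 2^-1) 1).
  + by apply: eq_bigr => p _; rewrite mxE pos_rootE mul1r.
  + by move=> i j; rewrite pos_adjC.
  + by move=> i; rewrite pos_adjii.
  + by move=> i j /(p_pos_sym T) ->; rewrite mul1r.
- rewrite (indic _ (fun i => p_half T i - 2^-1)); apply: eq_bigr => i _.
  by rewrite mxE basis_vecE.
- rewrite (indic _ (fun i => 2 * (p_loop T i - 2^-1))); apply: eq_bigr => i _.
  by rewrite mxE /loop_root mxE basis_vecE mulrCA mulrA.
Qed.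

Lemma mean_score_support (T : coxeter_tournament R G) l :
  dotp l (mean_score T) <= support_fun G l.
Proof.
have le (t d : R) : 0 <= t <= 1 -> (t - 2^-1) * d <= `|d| / 2.
  by move=> /andP[t0 t1]; case: (ger0P d) => d0; nra.
rewrite mean_score_roots /support_fun fsbig_graph_roots !dotpDr !dotp_sumr.
do 3?[apply: lerD]; apply: ler_sum => i iP; rewrite dotpZr; apply: le.
- by apply: p_neg_bounds; case/andP: iP.
- by apply: p_pos_bounds; case/andP: iP.
- exact: p_half_bounds.
- exact: p_loop_bounds.
Qed.

(** A coefficient c_a in [-1/2, 1/2] becomes the probability 1/2 + c_a on the
    edge of a; for a negative edge this is the probability that its larger end
    wins. *)
Lemma tournament_of_coefficients (c : 'rV[R]_n -> R) :
    (forall a, `|c a| <= 2^-1) ->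
  exists T : coxeter_tournament R G,
    mean_score T = \sum_(a \in @graph_roots R n G) c a *: a.
Proof.
move=> c1.
have bnd a : 0 <= 2^-1 + c a <= 1 /\ 0 <= 2^-1 - c a <= 1.
  by have := c1 a; rewrite ler_norml => /andP[ca1 ca2]; split; apply/andP; split; lra.
pose pn (i j : 'I_n) := if (j < i)%N then 2^-1 + c (e i - e j) else 2^-1 - c (e j - e i).
have pn_bounds i j : neg_adj G i j -> 0 <= pn i j <= 1.
  by rewrite /pn; case: ifP => _ _; [exact: (bnd _).1|exact: (bnd _).2].
have pn_anti i j : neg_adj G i j -> pn i j = 1 - pn j i.
  rewrite /pn; case: ltngtP => [_|_|/val_inj->]; rewrite ?neg_adjii // => _; lra.
pose pp (i j : 'I_n) := 2^-1 + c (e i + e j).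
have pp_sym i j : pos_adj G i j -> pp i j = pp j i by rewrite /pp [e i + e j]addrC.
pose T := (@CoxeterTournament R n G pn pp (fun i => 2^-1 + c (e i))
  (fun i => 2^-1 + c (2 *: e i)) pn_bounds pn_anti
  (fun i j _ => (bnd (e i + e j)).1) pp_sym
  (fun i _ => (bnd (e i)).1) (fun i _ => (bnd (2 *: e i)).1)).
exists T.
rewrite mean_score_roots fsbig_graph_roots /=.
congr (_ + _ + _ + _); apply: eq_bigr => p pP; congr (_ *: _); rewrite /pn /pp.
- by case/andP: pP => -> _; rewrite addrC addKr.
- by rewrite addrC addKr.
- by rewrite addrC addKr.
- by rewrite addrC addKr.
Qed.

Lemma mean_scoreP x :
  (exists T : coxeter_tournament R G, mean_score T = x) <->
  (forall l, dotp l x <= support_fun G l).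
Proof.
split=> [[T <-] l|hx]; first exact: mean_score_support.
have finG := @graph_roots_finite R n G.
have [||c c1 ->] := @segment_sum_separation R n _ id
  (finmap.enum_fset (fset_set (@graph_roots R n G))) x.
- exact: finmap.fset_uniq.
- by move=> l; have := hx l; rewrite /support_fun fsbig_finite.
have [T TE] := tournament_of_coefficients c1.
by exists T; rewrite TE fsbig_finite.
Qed.

End MeanScores.

(** * Reduction to sign vectors *)

Section SignVectors.
Variables (R : realType) (n : nat) (G : signed_graph n).
Implicit Types l s x : 'rV[R]_n.

Local Notation e := (@basis_vec R n).

(** The fixed points of the sign function are 0, 1 and -1. *)
Definition sign_vector s := forall i, Num.sg (s 0 i) = s 0 i.

Definition supp l : {set 'I_n} := [set i | l 0 i != 0].

Lemma support_funZ t l : 0 <= t -> support_fun G (t *: l) = t * support_fun G l.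
Proof.
have finG := @graph_roots_finite R n G.
move=> t0; rewrite /support_fun !fsbig_finite // mulr_sumr.
by apply: eq_bigr => a _; rewrite dotpZl normrM (ger0_norm t0) mulrA.
Qed.

(** The function h is linear on each cone where no pairing with a root changes
    sign. *)
Lemma support_funD l l' :
    (forall a, @graph_roots R n G a -> 0 <= dotp l a * dotp l' a) ->
  support_fun G (l + l') = support_fun G l + support_fun G l'.
Proof.
have finG := @graph_roots_finite R n G.
move=> ll'; rewrite /support_fun !fsbig_finite // -big_split /= !big_seq.
apply: eq_bigr => a; rewrite in_fset_set // inE => /ll' aa.
rewrite -mulrDl dotpDl; congr (_ / _).
case: (ger0P (dotp l a)) aa => la; case: (ger0P (dotp l' a)) => l'a aa.
- by rewrite ger0_norm // addr_ge0.
- have -> : dotp l a = 0 by nra.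
  by rewrite !add0r ltr0_norm.
- have -> : dotp l' a = 0 by nra.
  by rewrite !addr0 ltr0_norm.
- by rewrite ltr0_norm; lra.
Qed.

Lemma support_fun_ge0 l : 0 <= support_fun G l.
Proof. by apply: fsumr_ge0 => a _; rewrite divr_ge0. Qed.

(** With m the least nonzero |l_i| and s the sign vector of l, the vector
    l - m s has smaller support, and each of its entries is zero or has the sign
    of the same entry of l.  Differences and sums of two entries have weakly the
    same signs in s and in l - m s: if two entries of s cancel there, the pairing
    with s is zero, and otherwise the two contributions never oppose each other,
    neither in s nor in l - m s.
    Hence h(l) = m h(s) + h(l - m s), and induction on the support applies. *)
Lemma sign_vector_ineq x :
    (forall s, sign_vector s -> dotp s x <= support_fun G s) ->
  forall l, dotp l x <= support_fun G l.
Proof.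
move=> hs l; have [k] := ubnP #|supp l|; elim: k l => // k IH l lk.
have [l0|[i0 li0]] := set_0Vmem (supp l).
  have -> : l = 0.
    apply/rowP => i; rewrite mxE; apply/eqP; apply: contraT => li.
    by have := finset.in_set0 i; rewrite -l0 inE li.
  by rewrite dotpC -(scale0r x) dotpZr mul0r support_fun_ge0.
rewrite inE in li0.
case: (@arg_minP _ _ _ i0 (fun i => l 0 i != 0) (fun i => `|l 0 i|) li0).
move=> i li min_i; have [m mE] : exists m, m = `|l 0 i| by eexists.
rewrite -mE in min_i.
have m0 : 0 < m by rewrite mE normr_gt0.
pose s : 'rV[R]_n := \row_j Num.sg (l 0 j).
have sE j : s 0 j = Num.sg (l 0 j) by rewrite mxE.
have s_sign : sign_vector s by move=> j; rewrite sE sgr_id.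
pose l' := l - m *: s.
have l'E j : l' 0 j = l 0 j - m * Num.sg (l 0 j) by rewrite !mxE.
have sub : (#|supp l'| < k)%N.
  apply: (@leq_trans #|supp l|); last by rewrite -ltnS.
  apply: proper_card; apply/properP; split.
    apply/fintype.subsetP => j; rewrite !inE l'E; apply: contra => /eqP->.
    by rewrite sgr0 mulr0 subrr.
  exists i; rewrite !inE ?li // negbK l'E mE mulrC -numEsg subrr.
  by [].
have -> : l = m *: s + l' by rewrite addrC subrK.
rewrite support_funD.
  rewrite dotpDl dotpZl support_funZ ?(ltW m0) //.
  by rewrite lerD ?IH // ler_pM2l // hs.
(* The pairings of m s and of l - m s with a root, written with the two entries
   y and z of l that it involves; z = 0 covers half-edges and loops. *)
have coh (y z : R) : (y != 0 -> m <= `|y|) -> (z != 0 -> m <= `|z|) ->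
   0 <= (m * Num.sg y - m * Num.sg z) * ((y - m * Num.sg y) - (z - m * Num.sg z)) /\
   0 <= (m * Num.sg y + m * Num.sg z) * ((y - m * Num.sg y) + (z - m * Num.sg z)).
  case: (sgrP y) => [->|y0|y0] my; case: (sgrP z) => [->|z0|z0] mz;
    try have {}my := my (lt0r_neq0 y0); try have {}my := my (ltr0_neq0 y0);
    try have {}mz := mz (lt0r_neq0 z0); try have {}mz := mz (ltr0_neq0 z0);
    by split; nra.
move=> a; rewrite !dotpZl.
have ms j : m * s 0 j = m * Num.sg (l 0 j) by rewrite sE.
case=> [[[[i1 [j1 [_ _ ->]]]|[i1 [j1 [_ _ ->]]]]|[i1 _ ->]]|[i1 _ ->]].
- rewrite !dotpBr !dotp_basis [m * (_ - _)]mulrBr !ms !l'E.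
  by have [] := coh _ _ (@min_i i1) (@min_i j1).
- rewrite !dotpDr !dotp_basis [m * (_ + _)]mulrDr !ms !l'E.
  by have [] := coh _ _ (@min_i i1) (@min_i j1).
- rewrite !dotp_basis ms l'E.
  have [] := coh (l 0 i1) 0 (@min_i i1); first by rewrite eqxx.
  by rewrite sgr0 mulr0 !subr0.
- rewrite !dotpZr !dotp_basis [m * (2 * _)]mulrCA ms l'E mulrACA pmulr_rge0 ?mulr_gt0 //.
  have [] := coh (l 0 i1) 0 (@min_i i1); first by rewrite eqxx.
  by rewrite sgr0 mulr0 !subr0.
Qed.

(** If the support of s misses only m, then 2 s = (s + e_m) + (s - e_m).  On a
    root e_i - e_j or e_i + e_j that avoids m both terms take the same value; on
    a root that involves m one of them vanishes, since the other entry of s is 1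
    or -1.  So h is additive here, which would fail for the roots e_m and
    2 e_m. *)
Lemma sign_vector_ineq_spin x :
    half_edges G = finset.set0 -> loops G = finset.set0 ->
    (forall s, sign_vector s -> #|supp s|.+1 != n -> dotp s x <= support_fun G s) ->
  forall s, sign_vector s -> dotp s x <= support_fun G s.
Proof.
move=> noH noL hs s ss; have [cs|cs] := eqVneq #|supp s|.+1 n; last exact: hs.
have : (0 < #|~: supp s|)%N.
  by have := cardsC (supp s); rewrite card_ord; lia.
rewrite card_gt0 => /set0Pn[m]; rewrite !inE negbK => /eqP sm.
have spin (c : R) : c = 1 \/ c = -1 -> dotp (s + c *: e m) x <= support_fun G (s + c *: e m).
  move=> c1.
  have sE k : (s + c *: e m) 0 k = if k == m then c else s 0 k.
    by rewrite mxE [X in _ + X]mxE basis_vecE; case: eqP => [->|_];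
      rewrite ?sm ?mulr1 ?add0r ?mulr0 ?addr0.
  have c0 : c != 0 by case: c1 => ->; rewrite ?oppr_eq0 oner_eq0.
  apply: hs => [k|].
    by rewrite sE; case: eqP => // _; case: c1 => ->; rewrite ?sgrN sgr1.
  have -> : supp (s + c *: e m) = m |: supp s.
    by apply/setP => k; rewrite !inE sE; case: (k =P m) => //= _; rewrite ?c0.
  by rewrite cardsU1 inE sm eqxx /= add1n cs neq_ltn ltnSn orbT.
have := spin 1; have := spin (-1).
rewrite scale1r scaleN1r => /(_ (or_intror erefl)) hN /(_ (or_introl erefl)) hP.
have D : (s + e m) + (s - e m) = 2 *: s.
  by rewrite addrACA subrr addr0 -mulr2n scaler_nat.
rewrite -(@ler_pM2l _ 2) // -dotpZl -support_funZ // -D.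
rewrite dotpDl support_funD ?lerD // => a.
(* Since m is the only zero entry, the others are 1 or -1. *)
have sq i : i != m -> s 0 i * s 0 i = 1.
  move=> im; have si : s 0 i != 0.
    have : i \in supp s.
      suff -> : supp s = ~: [set m] by rewrite !inE.
      apply/eqP; rewrite eqEcard cardsC1 card_ord -[X in (X.-1 <= _)%N]cs leqnn andbT.
      by apply/fintype.subsetP => k; rewrite !inE; apply: contra => /eqP->; rewrite sm.
    by rewrite inE.
  by move: (ss i) si; case: sgrP => [->|_ <-|_ <-]; rewrite ?eqxx // => _; lra.
have plusE k : (s + e m) 0 k = s 0 k + (k == m)%:R by rewrite mxE basis_vecE.
have minusE k : (s - e m) 0 k = s 0 k - (k == m)%:R.
  by rewrite mxE [X in _ + X]mxE basis_vecE.
rewrite /graph_roots noH noL.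
case=> [[[[i [j [ji _ ->]]]|[i [j [ji _ ->]]]]|[i + _]]|[i + _]]; rewrite ?inE //.
all: rewrite ?(dotpBr _ (e _)) ?(dotpDr _ (e _)) !dotp_basis !plusE !minusE.
all: have : i != j by rewrite -val_eqE gtn_eqF.
all: have [->|im] := eqVneq i m; have [->|jm] := eqVneq j m;
  rewrite ?eqxx // => _; rewrite ?sm /= ?subr0 ?addr0 -?expr2 ?sqr_ge0 //.
all: try have := sq _ im; try have := sq _ jm; nra.
Qed.

End SignVectors.

(** * Sign vectors as conjugates of fundamental weights *)

Section WeylOrbits.
Variables (R : realType) (n : nat) (Phi : root_type).
Implicit Types (v s : 'rV[R]_n) (i j k : 'I_n) (A B : {set 'I_n}).

Local Notation e := (@basis_vec R n).
Local Notation wc := (@weight_conjugates R n Phi).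

(** [swap] is the reflection in e_i - e_j, [flip] the one in any nonzero multiple
    of e_i; in type D the flips belong to the Weyl group only in pairs. *)
Definition swap i j v : 'rV[R]_n := \row_k v 0 (tperm i j k).

Definition flip i v : 'rV[R]_n := \row_k (if k == i then - v 0 k else v 0 k).

Definition indicator A : 'rV[R]_n := \row_k (k \in A)%:R.

Definition negs v : {set 'I_n} := [set k | v 0 k < 0].

Lemma weight_conjugates_reflection a v :
  root_system Phi a -> wc v -> wc (reflection a v).
Proof.
move=> Pa [w Ww [k ->]]; exists (reflection a \o w); last by exists k.
exact: weyl_reflection.
Qed.

Lemma pair_root_system i j (b c : bool) : i != j ->
  @root_system R n Phi ((-1) ^+ b *: e i + (-1) ^+ c *: e j).
Proof.
by move=> ij; case: Phi => /=; try left; exists i, j, b, c.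
Qed.

Lemma reflection_sub i j v : i != j -> reflection (e i - e j) v = swap i j v.
Proof.
move=> ij; rewrite /reflection !dotpBr !dotp_basis.
have E k : (e i - e j) 0 k = (k == i)%:R - (k == j)%:R.
  by rewrite mxE [X in _ + X]mxE !basis_vecE.
have ji : (j == i) = false by rewrite eq_sym (negPf ij).
have -> : (e i - e j) 0 i - (e i - e j) 0 j = 2.
  by rewrite !E !eqxx ji (negPf ij) /=; lra.
have -> : 2 * (v 0 i - v 0 j) / 2 = v 0 i - v 0 j by lra.
apply/rowP => k; rewrite mxE [X in _ + X]mxE [X in _ - X]mxE E [RHS]mxE.
have [->|ki] := eqVneq k i; first by rewrite (negPf ij) tpermL /=; lra.
have [->|kj] := eqVneq k j; first by rewrite tpermR /=; lra.
by rewrite tpermD 1?eq_sym //=; lra.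
Qed.

Lemma reflection_add i j v : i != j ->
  reflection (e i + e j) v = flip i (flip j (swap i j v)).
Proof.
move=> ij; rewrite /reflection !dotpDr !dotp_basis.
have E k : (e i + e j) 0 k = (k == i)%:R + (k == j)%:R.
  by rewrite mxE !basis_vecE.
have ji : (j == i) = false by rewrite eq_sym (negPf ij).
have -> : (e i + e j) 0 i + (e i + e j) 0 j = 2.
  by rewrite !E !eqxx ji (negPf ij) /=; lra.
have -> : 2 * (v 0 i + v 0 j) / 2 = v 0 i + v 0 j by lra.
apply/rowP => k; rewrite mxE [X in _ + X]mxE [X in _ - X]mxE E !mxE.
have [->|ki] := eqVneq k i; first by rewrite (negPf ij) tpermL /=; lra.
have [->|kj] := eqVneq k j; first by rewrite tpermR /=; lra.
by rewrite tpermD 1?eq_sym //=; lra.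
Qed.

Lemma reflection_axis m i v : m != 0 -> reflection (m *: e i) v = flip i v.
Proof.
move=> m0; rewrite /reflection !dotpZr dotp_basis dotpC dotpZr dotp_basis.
rewrite basis_vecE eqxx mulr1.
apply/rowP => k; rewrite mxE [X in _ + X]mxE [X in _ - X]mxE [X in _ - _ * X]mxE.
rewrite basis_vecE [RHS]mxE; have [->|ki] := eqVneq k i; last by rewrite !mulr0 subr0.
by rewrite /=; field.
Qed.

Lemma swapK i j : involutive (swap i j).
Proof. by move=> v; apply/rowP => k; rewrite !mxE tpermK. Qed.

Lemma flipK i : involutive (flip i).
Proof. by move=> v; apply/rowP => k; rewrite !mxE; case: eqP => // _; rewrite opprK. Qed.

Lemma flipZ i c v : flip i (c *: v) = c *: flip i v.
Proof. by apply/rowP => k; rewrite !mxE; case: eqP => // _; rewrite mulrN. Qed.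

Lemma flip_id i v : v 0 i = 0 -> flip i v = v.
Proof. by move=> vi; apply/rowP => k; rewrite !mxE; case: eqP => // ->; rewrite vi oppr0. Qed.

Lemma weight_conjugates_swap i j v : wc v -> wc (swap i j v).
Proof.
move=> wv; have [<-|ij] := eqVneq i j.
  by have -> : swap i i v = v by apply/rowP => k; rewrite mxE tperm1 perm1.
rewrite -reflection_sub //; apply: weight_conjugates_reflection wv.
by have := @pair_root_system i j false true ij; rewrite expr0 expr1 scale1r scaleN1r.
Qed.

(** Two sign changes are available in every type: the reflections in e_i - e_j
    and e_i + e_j commute and their product negates both coordinates. *)
Lemma weight_conjugates_flip2 i j v : i != j -> wc v -> wc (flip i (flip j v)).
Proof.
move=> ij wv; rewrite -[v](swapK i j) -reflection_add //.
apply: weight_conjugates_reflection; last exact: weight_conjugates_swap.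
by have := @pair_root_system i j false false ij; rewrite expr0 !scale1r.
Qed.

Lemma weight_conjugates_flip i v : Phi <> TypeD -> wc v -> wc (flip i v).
Proof.
move=> PD wv.
have [m m0 Pm] : exists2 m : R, m != 0 & root_system Phi (m *: e i).
  case: Phi PD => // _; [exists 1|exists 2]; rewrite ?oner_eq0 ?pnatr_eq0 //=;
    by right; exists i, false; rewrite expr0 [RHS]scale1r.
by rewrite -(reflection_axis i v m0); exact: weight_conjugates_reflection.
Qed.

(** Sets of the same size are exchanged by swaps: trade an element of A outside
    B for one of B outside A until A = B. *)
Lemma weight_conjugates_indicator c A B : #|A| = #|B| ->
  wc (c *: indicator B) -> wc (c *: indicator A).
Proof.
have [k] := ubnP #|A :\: B|; elim: k A => // k IH A Ak AB wB.
have [AB0|[i iAB]] := set_0Vmem (A :\: B).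
  suff -> : A = B by [].
  by apply/eqP; rewrite eqEcard AB leqnn andbT -finset.setD_eq0 AB0.
have [j jBA] : exists j, j \in B :\: A.
  apply/set0Pn; apply: contraTneq iAB => /eqP; rewrite finset.setD_eq0 => BA.
  have /eqP -> : B == A by rewrite eqEcard BA AB leqnn.
  by rewrite finset.setDv inE.
have [[iA iB] [jB jA]] : (i \in A /\ i \notin B) /\ (j \in B /\ j \notin A).
  by move: iAB jBA; rewrite !inE => /andP[-> ->] /andP[-> ->].
pose A' := j |: (A :\ i).
have jAi : j \notin A :\ i by rewrite !inE (negPf jA) andbF.
have -> : c *: indicator A = swap i j (c *: indicator A').
  apply/rowP => l; rewrite !mxE; congr (_ * (nat_of_bool _)%:R).
  case: tpermP => [->|->|/eqP li /eqP lj]; rewrite !inE ?eqxx ?iA //.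
    by have /negPf-> : i != j by [apply: contraNneq jA => <-]; rewrite (negPf jA).
  by rewrite (negPf li) (negPf lj).
apply/weight_conjugates_swap/IH => //; last first.
  by rewrite -AB cardsU1 jAi (cardsD1 i A) iA.
rewrite -ltnS; apply: leq_trans Ak; rewrite ltnS; apply: proper_card.
apply/properP; split.
  apply/fintype.subsetP => l; rewrite !inE => /andP[lB].
  case/orP => [/eqP lj|/andP[_ ->]]; last by rewrite lB.
  by rewrite lj jB in lB.
by exists i; rewrite !inE ?iA ?iB // eqxx /= orbF; apply: contraNneq jA => <-.
Qed.

Lemma sum_basisE (P : pred 'I_n) k : (\sum_(i < n | P i) e i) 0 k = (P k)%:R.
Proof.
rewrite summxE (eq_bigr _ (fun i _ => basis_vecE R i k)).
case: (boolP (P k)) => Pk.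
  rewrite (bigD1 k) //= eqxx big1 ?addr0 // => i /andP[_ ik].
  by rewrite eq_sym (negPf ik).
by rewrite big1 // => i Pi; case: eqP Pk => // ->; rewrite Pi.
Qed.

(** The factor is 1/2 when the weight is a spin weight.  In type D no fundamental
    weight is proportional to e_1 + ... + e_(n-1). *)
Lemma indicator_conjugate A : (0 < #|A|)%N ->
    (Phi = TypeD -> #|A|.+1 != n) ->
  exists2 c : R, 0 < c & wc (c *: indicator A).
Proof.
move=> A0 AD.
have kn : (#|A|.-1 < n)%N by rewrite prednK // -[X in (_ <= X)%N]card_ord max_card.
pose k := Ordinal kn; pose B := [set i : 'I_n | (i <= k)%N].
have AB : #|A| = #|B|.
  rewrite -[#|B|]sum1_card (eq_bigl (fun i : 'I_n => (i < #|A|)%N)).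
    by rewrite -(big_ord_widen _ (fun=> 1%N)) ?sum1_card ?card_ord //; lia.
  by move=> i; rewrite inE -(prednK A0) ltnS.
have sB : \sum_(i < n | (i <= k)%N) e i = indicator B.
  by apply/rowP => i; rewrite sum_basisE mxE inE.
suff [c c0 cw] : exists2 c : R, 0 < c & fundamental_weight R Phi k = c *: indicator B.
  exists c => //; apply: (weight_conjugates_indicator AB); rewrite -cw.
  by exists id; [exact: weyl_id|exists k].
have half : 0 < 2^-1 :> R by rewrite invr_gt0.
rewrite /fundamental_weight sB; case: Phi AD => AD.
- by case: ifP => _; [exists 2^-1|exists 1; rewrite ?scale1r].
- by exists 1; rewrite ?scale1r.
- case: ifP => _; first by exists 2^-1.
  have -> : (k.+2 == n) = false by rewrite /= prednK //; exact/negbTE/AD.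
  by exists 1; rewrite ?scale1r.
Qed.

(** Remove the negative entries by sign changes.  In type D an entry can be
    flipped together with a zero entry, or together with another negative entry;
    if neither exists, s has full support and a single negative entry, which a
    swap moves to the last place, where s/2 is the other spin weight. *)
Lemma sign_vector_conjugate s : (Phi = TypeD -> (2 <= n)%N) ->
    sign_vector s -> s != 0 -> (Phi = TypeD -> #|supp s|.+1 != n) ->
  exists2 c : R, 0 < c & wc (c *: s).
Proof.
move=> hD; have [k] := ubnP #|negs s|; elim: k s => // k IH s sk ss s0 sD.
have values i : [\/ s 0 i = 0, s 0 i = 1 | s 0 i = -1].
  by have := ss i; case: sgrP => [|_ <-|_ <-]; constructor.
have supp0 : (0 < #|supp s|)%N.
  rewrite card_gt0; apply: contraNneq s0 => s0; apply/eqP/rowP => i.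
  by rewrite mxE; apply/eqP; apply: contraT => si; rewrite -(finset.in_set0 i) -s0 inE.
have [neg0|[i]] := set_0Vmem (negs s).
  have -> : s = indicator (supp s).
    apply/rowP => i; rewrite mxE inE; have := finset.in_set0 i; rewrite -neg0 inE.
    by case: (values i) => ->; rewrite ?eqxx ?oner_eq0 // ltrN10.
  exact: indicator_conjugate.
rewrite inE => si; have {}si : s 0 i = -1.
  by case: (values i) si => -> //; rewrite ?ltxx // ltr10.
have flip_sign v j : sign_vector v -> sign_vector (flip j v).
  by move=> sv l; rewrite mxE; case: eqP => _; rewrite ?sgrN sv.
have flip_supp v j : supp (flip j v) = supp v.
  by apply/setP => l; rewrite !inE mxE; case: (l =P j) => _; rewrite ?oppr_eq0.
(* One move of the induction: f keeps the support of s, removes a negative entry,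
   stays within the conjugates, and is undone by applying it once more. *)
have step (f : 'rV[R]_n -> 'rV[R]_n) :
    (forall c, f (c *: f s) = c *: s) -> (forall v, wc v -> wc (f v)) ->
    sign_vector (f s) -> supp (f s) = supp s ->
    (#|negs (f s)| < #|negs s|)%N ->
  exists2 c : R, 0 < c & wc (c *: s).
  move=> fK fw fss fsupp lt.
  have [||||c c0 wf] := IH (f s).
  - exact: leq_trans lt _.
  - exact: fss.
  - apply: contraTneq supp0 => f0; rewrite -fsupp f0 -leqNgt leqn0 cards_eq0.
    by apply/eqP/setP => l; rewrite !inE mxE eqxx.
  - by rewrite fsupp.
  - by exists c => //; rewrite -fK; exact: fw.
have i_neg : i \in negs s by rewrite inE si ltrN10.
have less : (#|negs (flip i s)| < #|negs s|)%N.
  apply: proper_card; apply/properP; split; last first.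
    by exists i => //; rewrite inE mxE eqxx si opprK -leNgt ler01.
  apply/fintype.subsetP => l; rewrite !inE mxE; case: eqP => // ->.
  by rewrite si opprK ltNge ler01.
have [PD|PD] := pselect (Phi = TypeD); last first.
  apply: (step (flip i)) => //; last exact: flip_sign.
    by move=> c; rewrite flipZ flipK.
  by move=> v; exact: weight_conjugates_flip.
have flip2C j v : flip i (flip j v) = flip j (flip i v).
  by apply/rowP => l; rewrite !mxE; do 2!case: (l == _).
have [[z sz]|nz] := pselect (exists z, s 0 z = 0).
  have iz : i != z.
    by apply/eqP => iz; move: sz; rewrite -iz si => /eqP; rewrite oppr_eq0 oner_eq0.
  apply: (step (fun v => flip i (flip z v))).
  - by move=> c; rewrite !flipZ flip2C !flipK.
  - by move=> v; exact: weight_conjugates_flip2.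
  - by apply/flip_sign/flip_sign.
  - by rewrite !flip_supp.
  - by rewrite (flip_id sz).
have [[j [ij sj]]|oneneg] := pselect (exists j, i != j /\ s 0 j = -1).
  apply: (step (fun v => flip i (flip j v))).
  - by move=> c; rewrite !flipZ flip2C !flipK.
  - by move=> v; exact: weight_conjugates_flip2.
  - by apply/flip_sign/flip_sign.
  - by rewrite !flip_supp.
  - apply: leq_ltn_trans less; apply: subset_leq_card.
    apply/fintype.subsetP => l; rewrite flip2C !inE [flip j _ _ _]mxE; case: eqP => // ->.
    by rewrite mxE eq_sym (negPf ij) sj opprK ltNge ler01.
have sE l : s 0 l = if l == i then -1 else 1.
  case: eqP => [->//|/eqP li]; case: (values l) => // sl; first by case: nz; exists l.
  by case: oneneg; exists l; rewrite eq_sym.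
exists 2^-1; first by rewrite invr_gt0.
have n2 := hD PD.
have k1 : (n - 2 < n)%N by lia.
have k2 : (n - 1 < n)%N by lia.
pose k0 := Ordinal k1; pose last := Ordinal k2.
(* The ordinal n - 2 is the index n - 1, that of the weight with a minus sign. *)
have wE l : fundamental_weight R TypeD k0 0 l = if l == last then - 2^-1 else 2^-1.
  have -> : fundamental_weight R TypeD k0 =
    2^-1 *: (\sum_(i < n | (i <= k0)%N) e i - \sum_(i < n | (k0 < i)%N) e i).
    rewrite /fundamental_weight /=.
    have -> : ((n - 2).+1 == n) = false by apply/eqP; lia.
    by have -> : (n - 2).+2 == n by apply/eqP; lia.
  rewrite mxE [X in _ * X]mxE [X in _ + X]mxE !sum_basisE -val_eqE /=.
  have := ltn_ord l => ln.
  have -> : ((l : nat) == n - 1)%N = (n - 2 < l)%N by lia.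
  have -> : (l <= n - 2)%N = ~~ (n - 2 < l)%N by lia.
  by case: (n - 2 < l)%N => /=; lra.
have -> : 2^-1 *: s = swap i last (fundamental_weight R TypeD k0).
  apply/rowP => l; rewrite !mxE -/(fundamental_weight R TypeD k0) wE sE.
  have -> : (tperm i last l == last) = (l == i).
    by rewrite -[X in _ == X](tpermL i last) (inj_eq perm_inj).
  by case: eqP => _; rewrite ?mulrN1 ?mulr1.
apply: weight_conjugates_swap; exists id; first exact: weyl_id.
by exists k0; rewrite PD.
Qed.

End WeylOrbits.

(** * Mean score sequences *)

Theorem theorem3p2 (R : realType) (n : nat) (Phi : root_type)
    (hD : Phi = TypeD -> (2 <= n)%N) (G : signed_graph n)
    (hG : is_Phi_graph Phi G) (x : 'rV[R]_n) :
  (exists T : coxeter_tournament R G, mean_score T = x) <->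
  (forall l : 'rV[R]_n, weight_conjugates Phi l ->
     dotp l x <= graph_mu G l).
Proof.
rewrite mean_scoreP; split=> [hx l _|hx]; first by rewrite graph_muE.
apply: sign_vector_ineq.
have conj s : sign_vector s -> (Phi = TypeD -> #|supp s|.+1 != n) ->
    dotp s x <= support_fun G s.
  move=> ss sD; have [->|s0] := eqVneq s 0.
    by rewrite dotpC -(scale0r x) dotpZr mul0r support_fun_ge0.
  have [c c0 /hx] := sign_vector_conjugate hD ss s0 sD.
  by rewrite graph_muE dotpZl support_funZ ?(ltW c0) // ler_pM2l.
have [PD|PD] := pselect (Phi = TypeD); last by move=> s ss; exact: conj.
move: hG; rewrite PD => -[noH noL]; apply: sign_vector_ineq_spin => // s ss sn.
exact: conj.
Qed.
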